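(* For every positive integer $n \neq 7$, we have $N_n(\frac{1}{4}) = \lceil \frac{n}{7} \rceil$; moreover, $1 \le N_7(\frac{1}{4}) \le 2$.
   Context: For a positive integer $n$, let $\mathcal{P}_n$ denote the family of all sets of $n$ points in the Euclidean plane such that the distance between any two points of the set is at most $1$. For $0 < r \le 1$, let $N_n(r)$ be the largest integer $k$ such that for every $P \in \mathcal{P}_n$ there exists a circle of radius $r$ (i.e. a closed disc of radius $r$) which covers (contains) at least $k$ points of $P$. *)

(* Defs.v *)
From Stdlib Require Import Reals Lra List Arith.
Import ListNotations.
Open Scope R_scope.

Definition dist2 (p q : R * R) : R :=
  sqrt ((fst p - fst q) ^ 2 + (snd p - snd q) ^ 2).

Definition in_Pn (n : nat) (P : list (R * R)) : Prop :=
  NoDup P /\ length P = n /\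
  (forall p q, In p P -> In q P -> dist2 p q <= 1).

Definition covered (c : R * R) (r : R) (P : list (R * R)) : nat :=
  length (filter (fun p => if Rle_dec (dist2 c p) r then true else false) P).

Definition good (n : nat) (r : R) (k : nat) : Prop :=
  forall P, in_Pn n P -> exists c : R * R, (k <= covered c r P)%nat.

Definition is_N (n : nat) (r : R) (k : nat) : Prop :=
  good n r k /\ forall k', good n r k' -> (k' <= k)%nat.

(* Main.v *)
(** Lower bound: every set of diameter at most 1 lies in a regular hexagon of
    width 1 (Pál; a continuity argument on the support function makes the three
    midlines of supporting strips at mutual angles of 60 degrees concurrent), and
    that hexagon is the union of seven discs of radius 1/4, so pigeonhole applies.

    Upper bound, n <= 7m with m >= 2: take m slightly rotated copies of a hexagon
    whose vertices have alternating distances 1/2 + s and 1/2 - s from the origin.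
    Antipodal vertices are then at distance 1 and neighbours at distance
    sqrt (1/4 + 3 s^2) > 1/2, so a disc of radius 1/4 meets each copy at most once.
    Add m points of the segment from (-e, 0) to (e, 0), endpoints included.  If e
    is small compared with the rotations, a disc that meets the segment points
    contains at most one hexagon vertex; with s = e^2 no vertex is within 1/2 of
    both endpoints, so such a disc then misses one of the m points.
    For n <= 6 a single hexagon is enough. *)
Require Import Defs.
From Stdlib Require Import Reals Lra List Arith.
From Stdlib Require Import Lia Psatz Classical_Prop.
Open Scope R_scope.

(** * Squared distances and counts of covered points *)

Definition sqd (p q : R * R) : R := (fst p - fst q) ^ 2 + (snd p - snd q) ^ 2.

Lemma dist2_le (p q : R * R) (r : R) :
  0 <= r -> (dist2 p q <= r <-> sqd p q <= r ^ 2).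
Proof.
  intros Hr. unfold dist2. fold (sqd p q).
  assert (H0 : 0 <= sqd p q) by (apply Rplus_le_le_0_compat; apply pow2_ge_0).
  split; intros H.
  - rewrite <- (sqrt_sqrt _ H0). pose proof (sqrt_pos (sqd p q)). nra.
  - rewrite <- (sqrt_pow2 r Hr). now apply sqrt_le_1_alt.
Qed.

(** Parallelogram law: [|p - q|^2 + |2c - p - q|^2 = 2|c - p|^2 + 2|c - q|^2]. *)
Lemma sqd_disc (c p q : R * R) (r : R) :
  sqd c p <= r ^ 2 -> sqd c q <= r ^ 2 -> sqd p q <= 4 * r ^ 2.
Proof.
  unfold sqd. intros H1 H2.
  pose proof (pow2_ge_0 (2 * fst c - fst p - fst q)).
  pose proof (pow2_ge_0 (2 * snd c - snd p - snd q)). nra.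
Qed.

Definition inb (c : R * R) (r : R) (p : R * R) : bool :=
  if Rle_dec (dist2 c p) r then true else false.

Lemma inb_quarter (c p : R * R) : inb c (1/4) p = true <-> sqd c p <= (1/4) ^ 2.
Proof.
  unfold inb. rewrite <- dist2_le by lra.
  destruct (Rle_dec (dist2 c p) (1/4)); intuition discriminate.
Qed.

Lemma covered_app c r P Q : covered c r (P ++ Q) = (covered c r P + covered c r Q)%nat.
Proof. unfold covered. now rewrite filter_app, length_app. Qed.

Lemma covered_cons c r p P :
  covered c r (p :: P) = ((if inb c r p then 1 else 0) + covered c r P)%nat.
Proof. unfold covered, inb. simpl. destruct (Rle_dec _ _); reflexivity. Qed.

Lemma covered_firstn c r n P : (covered c r (firstn n P) <= covered c r P)%nat.
Proof. rewrite <- (firstn_skipn n P) at 2. rewrite covered_app. lia. Qed.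

Lemma covered_length c r P : (covered c r P <= length P)%nat.
Proof. apply filter_length_le. Qed.

Lemma covered_missing c r P p :
  In p P -> inb c r p = false -> (covered c r P < length P)%nat.
Proof.
  intros Hp Hc. apply in_split in Hp. destruct Hp as [P1 [P2 ->]].
  rewrite covered_app, covered_cons, Hc, length_app. simpl.
  pose proof (covered_length c r P1). pose proof (covered_length c r P2). lia.
Qed.

Lemma covered_pos c r P :
  (0 < covered c r P)%nat -> exists p, In p P /\ inb c r p = true.
Proof.
  induction P as [|p P IH]; [unfold covered; simpl; lia|].
  rewrite covered_cons. destruct (inb c r p) eqn:E.
  - intros _. exists p. now split; [left|].
  - intros H. destruct IH as [q [Hq Hc]]; [lia|]. exists q. now split; [right|].
Qed.

(** Covered points lie in pairwise different classes. It is applied with the hexagon copies as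
    classes, and with a single class for all vertices. *)
Lemma covered_classes c r m (f : nat -> R * R) (cl : nat -> nat) (l : list nat) :
  NoDup l ->
  (forall i, In i l -> (cl i < m)%nat) ->
  (forall i j, In i l -> In j l -> inb c r (f i) = true -> inb c r (f j) = true ->
     cl i = cl j -> i = j) ->
  (covered c r (map f l) <= m)%nat.
Proof.
  intros HN Hm Hinj. unfold covered. fold (inb c r).
  rewrite filter_map_swap, length_map.
  rewrite <- (length_map cl), <- (length_seq m 0).
  apply NoDup_incl_length.
  - apply NoDup_map_NoDup_ForallPairs; [|now apply NoDup_filter].
    intros i j Hi Hj. apply filter_In in Hi, Hj. apply Hinj; tauto.
  - intros k Hk. apply in_map_iff in Hk. destruct Hk as [i [<- Hi]].
    apply filter_In in Hi. apply in_seq. specialize (Hm i). intuition lia.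
Qed.

Lemma in_Pn_firstn n N P : in_Pn N P -> (n <= N)%nat -> in_Pn n (firstn n P).
Proof.
  intros [HN [HL HD]] Hn.
  assert (Hin : forall p, In p (firstn n P) -> In p P).
  { intros p Hp. rewrite <- (firstn_skipn n P). apply in_or_app. now left. }
  split; [|split].
  - rewrite <- (firstn_skipn n P) in HN. now apply NoDup_app_remove_r in HN.
  - rewrite length_firstn. lia.
  - auto.
Qed.

(** * Circumscribed hexagons *)

Definition dot (a b : R) (p : R * R) : R := a * fst p + b * snd p.

(** Support function of the convex hull of [p0 :: P]; the separate [p0] gives the maximum a base
    case. *)
Fixpoint supp (p0 : R * R) (P : list (R * R)) (a b : R) : R :=
  match P with
  | nil => dot a b p0
  | p :: P' => Rmax (dot a b p) (supp p0 P' a b)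
  end.

Lemma supp_ub p0 P a b p : In p (p0 :: P) -> dot a b p <= supp p0 P a b.
Proof.
  induction P as [|q P IH]; simpl.
  - intros [->|[]]. lra.
  - intros [->|[->|H]].
    + eapply Rle_trans; [apply IH; now left|apply Rmax_r].
    + apply Rmax_l.
    + eapply Rle_trans; [apply IH; now right|apply Rmax_r].
Qed.

Lemma supp_attained p0 P a b :
  exists p, In p (p0 :: P) /\ supp p0 P a b = dot a b p.
Proof.
  induction P as [|q P [p [Hp E]]]; simpl.
  - exists p0. auto.
  - unfold Rmax. destruct (Rle_dec _ _).
    + exists p. split; [destruct Hp; auto|assumption].
    + exists q. auto.
Qed.

Lemma continuity_Rmax f g :
  continuity f -> continuity g -> continuity (fun x => Rmax (f x) (g x)).
Proof.
  intros Hf Hg x.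
  apply (continuity_pt_locally_ext
    (fun x => / 2 * ((f x + g x) + Rabs (f x - g x))) _ 1 x Rlt_0_1).
  - intros y _. unfold Rmax, Rabs.
    destruct (Rcase_abs _); destruct (Rle_dec _ _); lra.
  - apply (continuity_pt_scal (fun x => (f x + g x) + Rabs (f x - g x))).
    apply (continuity_pt_plus (fun x => f x + g x) (fun x => Rabs (f x - g x))).
    + now apply continuity_pt_plus.
    + apply (continuity_pt_comp (fun x => f x - g x) Rabs).
      * now apply continuity_pt_minus.
      * apply Rcontinuity_abs.
Qed.

Lemma continuity_lin (f g : R -> R) a b :
  continuity f -> continuity g -> continuity (fun x => f x * a + g x * b).
Proof.
  intros Hf Hg.
  apply (continuity_plus (fun x => f x * a) (fun x => g x * b));
    apply continuity_mult; auto; apply continuity_const; intros ? ?; reflexivity.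
Qed.

Lemma continuity_supp p0 P (f g : R -> R) :
  continuity f -> continuity g -> continuity (fun x => supp p0 P (f x) (g x)).
Proof.
  intros Hf Hg. induction P as [|p P IH]; simpl; unfold dot.
  - now apply continuity_lin.
  - apply continuity_Rmax; [now apply continuity_lin|assumption].
Qed.

(** For a unit normal [(a, b)], twice the signed offset of the midline of the supporting strip. *)
Definition asym p0 P (a b : R) : R := supp p0 P a b - supp p0 P (- a) (- b).

Lemma asym_odd p0 P a b : asym p0 P (- a) (- b) = - asym p0 P a b.
Proof. unfold asym. rewrite !Ropp_involutive. ring. Qed.

Lemma continuity_asym p0 P (f g : R -> R) :
  continuity f -> continuity g -> continuity (fun x => asym p0 P (f x) (g x)).
Proof.
  intros Hf Hg. apply continuity_minus; apply continuity_supp; auto.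
  - now apply continuity_opp.
  - now apply continuity_opp.
Qed.

Definition h3 : R := sqrt 3 / 2.

Lemma h3_sq : h3 * h3 = 3 / 4.
Proof. unfold h3. pose proof (sqrt_sqrt 3 ltac:(lra)). nra. Qed.

Lemma h3_bounds : 0 < h3 < 867 / 1000.
Proof.
  pose proof h3_sq. assert (0 < h3).
  { unfold h3. pose proof (sqrt_lt_R0 3 ltac:(lra)). lra. }
  nra.
Qed.

(** The three directions are [(a, b)] turned by 0, 120 and 240 degrees. They add up to zero, so the
    three midlines are concurrent exactly when their offsets add up to zero. That sum changes sign
    under a half-turn, hence vanishes at some angle between 0 and [PI]. *)
Lemma balanced_direction p0 P :
  exists a b, a * a + b * b = 1 /\
    asym p0 P a b
    + asym p0 P (- a * / 2 + - b * h3) (a * h3 + - b * / 2)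
    + asym p0 P (- a * / 2 + b * h3) (- a * h3 + - b * / 2) = 0.
Proof.
  set (T := fun a b => asym p0 P a b
    + asym p0 P (- a * / 2 + - b * h3) (a * h3 + - b * / 2)
    + asym p0 P (- a * / 2 + b * h3) (- a * h3 + - b * / 2)).
  assert (Todd : forall a b, T (- a) (- b) = - T a b).
  { intros a b. unfold T.
    replace (- - a * / 2 + - - b * h3) with (- (- a * / 2 + - b * h3)) by ring.
    replace (- a * h3 + - - b * / 2) with (- (a * h3 + - b * / 2)) by ring.
    replace (- - a * / 2 + - b * h3) with (- (- a * / 2 + b * h3)) by ring.
    replace (- - a * h3 + - - b * / 2) with (- (- a * h3 + - b * / 2)) by ring.
    rewrite !asym_odd. ring. }
  assert (Tcont : continuity (fun x => T (cos x) (sin x))).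
  { pose proof continuity_cos as Hc. pose proof continuity_sin as Hs.
    pose proof (continuity_opp _ Hc) as Hc'. pose proof (continuity_opp _ Hs) as Hs'.
    unfold T.
    apply (continuity_plus
      (fun x => asym p0 P (cos x) (sin x)
        + asym p0 P (- cos x * / 2 + - sin x * h3) (cos x * h3 + - sin x * / 2))
      (fun x => asym p0 P (- cos x * / 2 + sin x * h3) (- cos x * h3 + - sin x * / 2))).
    - apply (continuity_plus (fun x => asym p0 P (cos x) (sin x))
        (fun x => asym p0 P (- cos x * / 2 + - sin x * h3) (cos x * h3 + - sin x * / 2)));
        apply continuity_asym; auto; now apply continuity_lin.
    - apply continuity_asym; now apply continuity_lin. }
  destruct (IVT_cor _ 0 PI Tcont) as [z [_ Hz]].
  - pose proof PI_RGT_0. lra.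
  - rewrite cos_PI, sin_PI, cos_0, sin_0.
    replace (T (-1) 0) with (- T 1 0) by (rewrite <- Todd; f_equal; lra).
    pose proof (Rle_0_sqr (T 1 0)) as H. unfold Rsqr in H. lra.
  - exists (cos z), (sin z). split; [|exact Hz].
    pose proof (sin2_cos2 z). unfold Rsqr in *. lra.
Qed.

(** The width of the strip is the projection of a difference [u - v] of two points of the set, hence
    at most 1. *)
Lemma supp_strip p0 P a b :
  a * a + b * b = 1 ->
  (forall p q, In p (p0 :: P) -> In q (p0 :: P) -> dist2 p q <= 1) ->
  forall p, In p (p0 :: P) -> Rabs (2 * dot a b p - asym p0 P a b) <= 1.
Proof.
  intros Hab HD p Hp. unfold asym.
  pose proof (supp_ub p0 P a b p Hp) as H1.
  pose proof (supp_ub p0 P (- a) (- b) p Hp) as H2.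
  destruct (supp_attained p0 P a b) as [u [Hu Eu]].
  destruct (supp_attained p0 P (- a) (- b)) as [v [Hv Ev]].
  pose proof (HD u v Hu Hv) as Huv.
  apply dist2_le in Huv; [|lra].
  assert (dot a b u + dot (- a) (- b) v <= 1).
  { unfold sqd, dot in *.
    set (x := fst u - fst v) in *. set (y := snd u - snd v) in *.
    replace (a * fst u + b * snd u + (- a * fst v + - b * snd v))
      with (a * x + b * y) by (unfold x, y; ring).
    (* Cauchy-Schwarz in the form [2(ax + by) <= (a^2 + b^2) + (x^2 + y^2) <= 2]. *)
    pose proof (pow2_ge_0 (a - x)). pose proof (pow2_ge_0 (b - y)). nra. }
  unfold dot in *. apply Rabs_le. lra.
Qed.

(** In the coordinates [(x, sqrt 3 * y)] this is the kite spanned by the hexagon's centre, a vertex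
    and the adjacent edge midpoints [(1/2, 0)] and [(1/4, 1/4)]. The segment joining these midpoints
    is a diameter of the outer disc, and [x + y = 1/4] is the common chord of the two circles. *)
Lemma side_sector x y :
  0 <= y -> y <= x -> 2 * x <= 1 -> x + 3 * y <= 1 ->
  x ^ 2 + 3 * y ^ 2 <= 1 / 16 \/ (x - 3 / 8) ^ 2 + 3 * (y - 1 / 8) ^ 2 <= 1 / 16.
Proof.
  intros. destruct (Rle_dec (x + y) (1 / 4)); [left; nra|right].
  destruct (Rle_dec x (1 / 4)); nra.
Qed.

Lemma top_sector x y :
  x <= y -> - x <= y -> x + 3 * y <= 1 -> - x + 3 * y <= 1 ->
  x ^ 2 + 3 * y ^ 2 <= 1 / 16 \/ x ^ 2 + 3 * (y - 1 / 4) ^ 2 <= 1 / 16.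
Proof.
  intros. destruct (Rle_dec y (1 / 8)); [left; nra|right].
  destruct (Rle_dec y (1 / 4)); nra.
Qed.

Lemma Rabs_le_bounds x a : Rabs x <= a -> - a <= x <= a.
Proof. unfold Rabs. destruct (Rcase_abs x); lra. Qed.

(** The hexagon's centre and the midpoints between neighbouring edge midpoints. *)
Definition centres7 : list (R * R) :=
  (0, 0) :: (3/8, 1/8) :: (0, 1/4) :: (-3/8, 1/8)
  :: (-3/8, -1/8) :: (0, -1/4) :: (3/8, -1/8) :: nil.

(* The coordinate [x] runs along an edge normal, and the orthogonal coordinate
   is [sqrt 3 * y], which keeps all constants rational. *)
Lemma hexagon_seven_discs x y :
  Rabs (2 * x) <= 1 -> Rabs (- x + 3 * y) <= 1 -> Rabs (- x - 3 * y) <= 1 ->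
  exists q, In q centres7 /\ (x - fst q) ^ 2 + 3 * (y - snd q) ^ 2 <= (1 / 4) ^ 2.
Proof.
  intros H1 H2 H3.
  apply Rabs_le_bounds in H1, H2, H3.
  assert (HC : forall q, In q centres7 ->
    (x - fst q) ^ 2 + 3 * (y - snd q) ^ 2 <= 1 / 16 ->
    exists q, In q centres7 /\ (x - fst q) ^ 2 + 3 * (y - snd q) ^ 2 <= (1 / 4) ^ 2).
  { intros q Hq H. exists q. split; [assumption|lra]. }
  unfold centres7 in HC at 1.
  assert (H : x ^ 2 + 3 * y ^ 2 <= 1 / 16 \/
    (x - 3/8) ^ 2 + 3 * (y - 1/8) ^ 2 <= 1 / 16 \/
    x ^ 2 + 3 * (y - 1/4) ^ 2 <= 1 / 16 \/
    (- x - 3/8) ^ 2 + 3 * (y - 1/8) ^ 2 <= 1 / 16 \/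
    (- x - 3/8) ^ 2 + 3 * (- y - 1/8) ^ 2 <= 1 / 16 \/
    x ^ 2 + 3 * (- y - 1/4) ^ 2 <= 1 / 16 \/
    (x - 3/8) ^ 2 + 3 * (- y - 1/8) ^ 2 <= 1 / 16).
  { assert (Hx : (- x) ^ 2 = x ^ 2) by ring.
    assert (Hy : (- y) ^ 2 = y ^ 2) by ring.
    (* The lines [y = 0], [y = x] and [y = -x] cut the hexagon into six kites; reflections in the
       axes reduce them to the two sector lemmas. *)
    destruct (Rle_dec 0 y), (Rle_dec y x), (Rle_dec y (- x)),
      (Rle_dec (- y) x), (Rle_dec (- y) (- x)); try (exfalso; lra);
    first
    [ destruct (side_sector x y); [lra..| |]; tauto
    | destruct (top_sector x y); [lra..| |]; tauto
    | destruct (side_sector (- x) y); [lra..| |]; rewrite ?Hx, ?Hy in *; tauto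
    | destruct (side_sector (- x) (- y)); [lra..| |]; rewrite ?Hx, ?Hy in *; tauto
    | destruct (top_sector x (- y)); [lra..| |]; rewrite ?Hx, ?Hy in *; tauto
    | destruct (side_sector x (- y)); [lra..| |]; rewrite ?Hx, ?Hy in *; tauto ]. }
  simpl In in HC.
  destruct H as [H|[H|[H|[H|[H|[H|H]]]]]];
    [ apply (HC (0, 0)) | apply (HC (3/8, 1/8)) | apply (HC (0, 1/4))
    | apply (HC (-3/8, 1/8)) | apply (HC (-3/8, -1/8)) | apply (HC (0, -1/4))
    | apply (HC (3/8, -1/8)) ]; simpl fst; simpl snd; try lra; tauto.
Qed.

Lemma seven_discs P :
  (forall p q, In p P -> In q P -> dist2 p q <= 1) ->
  exists L, length L = 7%nat /\
    forall p, In p P -> exists c, In c L /\ inb c (1/4) p = true.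
Proof.
  destruct P as [|p0 P].
  { intros _. exists (repeat (0, 0) 7). split; [reflexivity|]. intros p []. }
  intros HD. destruct (balanced_direction p0 P) as [a [b [Hab Hbal]]].
  pose proof h3_sq as Hh.
  pose proof (supp_strip p0 P a b Hab HD) as S1.
  pose proof (supp_strip p0 P (- a * / 2 + - b * h3) (a * h3 + - b * / 2)
    ltac:(nra) HD) as S2.
  pose proof (supp_strip p0 P (- a * / 2 + b * h3) (- a * h3 + - b * / 2)
    ltac:(nra) HD) as S3.
  set (A1 := asym p0 P a b) in *.
  set (A2 := asym p0 P (- a * / 2 + - b * h3) (a * h3 + - b * / 2)) in *.
  set (A3 := asym p0 P (- a * / 2 + b * h3) (- a * h3 + - b * / 2)) in *.
  (* Undoes the change of coordinates: scale by [2 * h3 = sqrt 3], translate to the common point of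
     the midlines, rotate by [(a, b)]. *)
  set (place := fun q : R * R =>
    let x := A1 / 2 + fst q in let y := 2 * h3 * ((A2 - A3) / 6 + snd q) in
    (x * a - y * b, x * b + y * a)).
  exists (map place centres7). split; [reflexivity|].
  intros p Hp. specialize (S1 p Hp). specialize (S2 p Hp). specialize (S3 p Hp).
  set (x := a * fst p + b * snd p - A1 / 2).
  set (y := (- b * fst p + a * snd p) * (2 * h3 / 3) - (A2 - A3) / 6).
  destruct (hexagon_seven_discs x y) as [q [Hq Hqd]].
  - unfold dot in S1. replace (2 * x) with (2 * (a * fst p + b * snd p) - A1)
      by (unfold x; field). exact S1.
  - unfold dot in S2. eapply Rle_trans; [|exact S2]. apply Req_le. f_equal.
    unfold x, y. nra.
  - unfold dot in S3. eapply Rle_trans; [|exact S3]. apply Req_le. f_equal.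
    unfold x, y. nra.
  - exists (place q). split; [now apply in_map|].
    apply inb_quarter. eapply Rle_trans; [|exact Hqd]. apply Req_le.
    assert (E1 : fst p = (x + A1 / 2) * a - 2 * h3 * (y + (A2 - A3) / 6) * b).
    { unfold x, y.
      transitivity (fst p * (a * a + b * b * (h3 * h3 * (4 / 3)))
        + a * b * snd p * (1 - h3 * h3 * (4 / 3))); [|field].
      rewrite Hh. replace (b * b) with (1 - a * a) by lra. field. }
    assert (E2 : snd p = (x + A1 / 2) * b + 2 * h3 * (y + (A2 - A3) / 6) * a).
    { unfold x, y.
      transitivity (snd p * (b * b + a * a * (h3 * h3 * (4 / 3)))
        + a * b * fst p * (1 - h3 * h3 * (4 / 3))); [|field].
      rewrite Hh. replace (b * b) with (1 - a * a) by lra. field. }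
    unfold sqd, place; simpl fst; simpl snd. cbv zeta. rewrite E1, E2.
    clearbody x y.
    transitivity ((a * a + b * b) *
      ((x - fst q) ^ 2 + 4 * (h3 * h3) * (y - snd q) ^ 2)); [field|].
    rewrite Hab, Hh. field.
Qed.

(** * Pigeonhole and the lower bound *)

Fixpoint total (r : R) (P L : list (R * R)) : nat :=
  match L with nil => 0%nat | c :: L' => (covered c r P + total r P L')%nat end.

(** Counting incidences by induction on the points: a new point lowers no summand and raises at
    least one. *)
Lemma total_cover r P L :
  (forall p, In p P -> exists c, In c L /\ inb c r p = true) ->
  (length P <= total r P L)%nat.
Proof.
  assert (Hnil : forall L, total r nil L = 0%nat).
  { intros L'. induction L' as [|c L' IH]; [reflexivity|exact IH]. }
  assert (Hcons : forall p P L, (total r P L <= total r (p :: P) L)%nat /\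
    ((exists c, In c L /\ inb c r p = true) ->
     (total r P L < total r (p :: P) L)%nat)).
  { intros p Q L'. induction L' as [|c L' [IH1 IH2]]; simpl.
    - split; [lia|]. intros [c [[] _]].
    - rewrite covered_cons. split; [lia|].
      intros [c' [[->|Hc'] Hin]].
      + rewrite Hin. lia.
      + specialize (IH2 (ex_intro _ c' (conj Hc' Hin))). lia. }
  induction P as [|p P IH]; intros H; simpl length.
  - lia.
  - destruct (Hcons p P L) as [_ HL].
    specialize (HL (H p (or_introl eq_refl))).
    specialize (IH (fun q Hq => H q (or_intror Hq))). lia.
Qed.

Lemma total_max r P L k :
  (forall c, (covered c r P <= k)%nat) -> (total r P L <= length L * k)%nat.
Proof.
  intros H. induction L as [|c L IH]; simpl; [lia|]. specialize (H c). lia.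
Qed.

Lemma good_ceil n : good n (1/4) ((n + 6) / 7)%nat.
Proof.
  intros P [_ [HL HD]].
  destruct (seven_discs P HD) as [L [HL7 Hcov]].
  apply total_cover in Hcov.
  set (q := ((n + 6) / 7)%nat).
  assert (Hq : (7 * q <= n + 6)%nat) by apply Nat.Div0.mul_div_le.
  apply NNPP. intros Hno.
  assert (Hall : forall c, (covered c (1/4) P <= q - 1)%nat).
  { intros c. destruct (le_lt_dec q (covered c (1/4) P)); [|lia].
    exfalso. apply Hno. now exists c. }
  pose proof (total_max (1/4) P L (q - 1) Hall) as Hmax. rewrite HL7 in Hmax.
  (* For [q = 0] the subtraction [q - 1] truncates and the count says nothing, but any centre will
     do. *)
  destruct q; [|lia]. apply Hno. exists (0, 0). lia.
Qed.

(** * Extremal configurations *)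

(** Cosine and sine of [j] times 60 degrees, tabulated for [j < 6]; the default branch serves
    [j = 5]. *)
Definition cos60 (j : nat) : R :=
  match j with 0%nat => 1 | 1%nat => 1/2 | 2%nat => -1/2 | 3%nat => -1 | 4%nat => -1/2 | _ => 1/2 end.

Definition sin60 (j : nat) : R :=
  match j with 0%nat => 0 | 1%nat => h3 | 2%nat => h3 | 3%nat => 0 | 4%nat => - h3 | _ => - h3 end.

Definition sgn (j : nat) : R :=
  match j with 0%nat => 1 | 1%nat => -1 | 2%nat => 1 | 3%nat => -1 | 4%nat => 1 | _ => -1 end.

(** The copy is rotated by the angle with cosine [c] and sine [d]; passing these instead of the
    angle keeps everything algebraic. *)
Definition vert (s c d : R) (j : nat) : R * R :=
  let rho := 1 / 2 + sgn j * s in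
  (rho * (cos60 j * c - sin60 j * d), rho * (sin60 j * c + cos60 j * d)).

Lemma sgn_cases j : sgn j = 1 \/ sgn j = -1.
Proof. do 6 (destruct j as [|j]; [simpl; lra|]). simpl; lra. Qed.

Lemma cos60_sin60 j : cos60 j * cos60 j + sin60 j * sin60 j = 1.
Proof.
  pose proof h3_sq. do 6 (destruct j as [|j]; [simpl; lra|]). simpl; lra.
Qed.

(** [D] and [C] are the cosine and sine of the angle from vertex [j] to vertex [j']. Equal parity
    means 120 degrees apart, opposite parity 60 or 180. *)
Lemma hexagon_angles j j' :
  (j < 6)%nat -> (j' < 6)%nat ->
  let D := cos60 j * cos60 j' + sin60 j * sin60 j' in
  let C := cos60 j * sin60 j' - sin60 j * cos60 j' in
  (j = j' /\ D = 1 /\ C = 0) \/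
  (j <> j' /\ sgn j' = sgn j /\ D = -1/2 /\ - h3 <= C <= h3) \/
  (j <> j' /\ sgn j' = - sgn j /\ D <= 1/2 /\ - h3 <= C <= h3).
Proof.
  intros Hj Hj'. cbv zeta.
  pose proof h3_sq as Hh. pose proof h3_bounds as Hb.
  do 6 (destruct j as [|j];
    [do 6 (destruct j' as [|j'];
       [simpl; first
          [ left; split; [reflexivity|lra]
          | right; left; split; [discriminate|lra]
          | right; right; split; [discriminate|lra] ]|]); lia|]); lia.
Qed.

(** A rotation by less than 6 degrees. *)
Definition small_rotation (c d : R) : Prop :=
  c * c + d * d = 1 /\ 99/100 <= c /\ 0 <= d <= 1/10.

(** Law of cosines, with the cosine of the total angle expanded by the addition formula. *)
Lemma vert_sqd s c d c' d' j j' :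
  c * c + d * d = 1 -> c' * c' + d' * d' = 1 ->
  sqd (vert s c d j) (vert s c' d' j') =
  (1/2 + sgn j * s) ^ 2 + (1/2 + sgn j' * s) ^ 2
  - 2 * ((1/2 + sgn j * s) * (1/2 + sgn j' * s)) *
    ((cos60 j * cos60 j' + sin60 j * sin60 j') * (c * c' + d * d')
     + (cos60 j * sin60 j' - sin60 j * cos60 j') * (d * c' - c * d')).
Proof.
  intros H H'. unfold sqd, vert. simpl fst; simpl snd.
  pose proof (cos60_sin60 j) as E. pose proof (cos60_sin60 j') as E'.
  set (r := 1/2 + sgn j * s). set (r' := 1/2 + sgn j' * s).
  transitivity (r ^ 2 * ((cos60 j * cos60 j + sin60 j * sin60 j) * (c * c + d * d))
    + r' ^ 2 * ((cos60 j' * cos60 j' + sin60 j' * sin60 j') * (c' * c' + d' * d'))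
    - 2 * (r * r') *
    ((cos60 j * cos60 j' + sin60 j * sin60 j') * (c * c' + d * d')
     + (cos60 j * sin60 j' - sin60 j * cos60 j') * (d * c' - c * d'))); [ring|].
  rewrite H, H', E, E'. ring.
Qed.

Lemma vert_norm s c d j :
  c * c + d * d = 1 ->
  fst (vert s c d j) ^ 2 + snd (vert s c d j) ^ 2 = (1/2 + sgn j * s) ^ 2.
Proof.
  intros H. unfold vert. simpl fst; simpl snd.
  transitivity ((1/2 + sgn j * s) ^ 2
    * ((cos60 j * cos60 j + sin60 j * sin60 j) * (c * c + d * d))); [ring|].
  rewrite H, cos60_sin60. ring.
Qed.

Lemma rotation_gap c d c' d' :
  small_rotation c d -> small_rotation c' d' ->
  98/100 <= c * c' + d * d' <= 1 /\ -1/10 <= d * c' - c * d' <= 1/10.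
Proof.
  unfold small_rotation. intros [H1 [H2 H3]] [H1' [H2' H3']].
  assert (c <= 1) by nra. assert (c' <= 1) by nra.
  pose proof (pow2_ge_0 (c - c')). pose proof (pow2_ge_0 (d - d')).
  repeat split; nra.
Qed.

Lemma same_radius_le1 r z :
  0 <= r <= 51/100 -> -6/10 <= z -> r ^ 2 + r ^ 2 - 2 * (r * r) * z <= 1.
Proof.
  intros Hr Hz. assert (HW : 0 <= r * r <= 2601/10000) by nra.
  destruct HW as [HW HW']. apply Rmult_le_compat_l with (1 := HW) in Hz. lra.
Qed.

(** For opposite parity the two radii add up to 1, so the triangle inequality suffices. For equal
    parity the directions are less than 126 degrees apart, which leaves ample room. *)
Lemma vert_diameter s c d c' d' j j' :
  0 <= s <= 1/100 -> small_rotation c d -> small_rotation c' d' ->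
  (j < 6)%nat -> (j' < 6)%nat ->
  sqd (vert s c d j) (vert s c' d' j') <= 1.
Proof.
  intros Hs R R' Hj Hj'. pose proof (rotation_gap _ _ _ _ R R') as [HK HS].
  destruct R as [H _], R' as [H' _].
  rewrite (vert_sqd _ _ _ _ _ _ _ H H').
  pose proof (hexagon_angles j j' Hj Hj') as Ht. cbv zeta in Ht.
  pose proof h3_bounds as Hb.
  assert (HKS : (c * c' + d * d') ^ 2 + (d * c' - c * d') ^ 2 = 1).
  { transitivity ((c * c + d * d) * (c' * c' + d' * d')); [ring|]. rewrite H, H'. ring. }
  assert (HDC : (cos60 j * cos60 j' + sin60 j * sin60 j') ^ 2
    + (cos60 j * sin60 j' - sin60 j * cos60 j') ^ 2 = 1).
  { transitivity ((cos60 j * cos60 j + sin60 j * sin60 j)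
      * (cos60 j' * cos60 j' + sin60 j' * sin60 j')); [ring|].
    rewrite !cos60_sin60. ring. }
  set (K := c * c' + d * d') in *. set (S := d * c' - c * d') in *.
  set (D := cos60 j * cos60 j' + sin60 j * sin60 j') in *.
  set (C := cos60 j * sin60 j' - sin60 j * cos60 j') in *.
  assert (HZ : -1 <= D * K + C * S).
  { pose proof (pow2_ge_0 (D + K)). pose proof (pow2_ge_0 (C + S)). nra. }
  clearbody K S D C. set (Z := D * K + C * S) in *.
  destruct Ht as [[<- [E1 E2]]|[[_ [Es [E1 E2]]]|[_ [Es _]]]].
  - assert (HZ0 : -6/10 <= Z) by (unfold Z; rewrite E1, E2; lra).
    apply same_radius_le1; [|exact HZ0]. destruct (sgn_cases j) as [-> | ->]; lra.
  - assert (HZ0 : -6/10 <= Z) by (unfold Z; rewrite E1; nra).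
    rewrite Es.
    apply same_radius_le1; [|exact HZ0]. destruct (sgn_cases j) as [-> | ->]; lra.
  - rewrite Es.
    assert (HW : 0 <= (1/2 + sgn j * s) * (1/2 + - sgn j * s))
      by (destruct (sgn_cases j) as [-> | ->]; nra).
    apply Rmult_le_compat_l with (1 := HW) in HZ. lra.
Qed.

Lemma separation_small r k x :
  49/100 <= r -> 0 <= x <= 2 - 2 * k -> 24/100 * x <= r ^ 2 + r ^ 2 - 2 * (r * r) * k.
Proof.
  intros Hr Hx. assert (HW : 24/100 <= r * r) by nra.
  assert (24/100 * x <= r * r * (2 - 2 * k)) by (apply Rmult_le_compat; lra).
  lra.
Qed.

Lemma separation_large r r' z :
  49/100 <= r -> 49/100 <= r' -> z <= 6/10 ->
  16/100 <= r ^ 2 + r' ^ 2 - 2 * (r * r') * z.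
Proof.
  intros Hr Hr' Hz. assert (HW : 24/100 <= r * r') by nra.
  assert (24/100 * (4/10) <= r * r' * (1 - z)) by (apply Rmult_le_compat; lra).
  pose proof (pow2_ge_0 (r - r')). lra.
Qed.

(** Equal indices lie on one circle, and their chord is controlled by the difference of the sines.
    Different indices stay more than 54 degrees apart. *)
Lemma vert_separation s c d c' d' j j' :
  0 <= s <= 1/100 -> small_rotation c d -> small_rotation c' d' ->
  (j < 6)%nat -> (j' < 6)%nat ->
  (j = j' -> 24/100 * (d - d') ^ 2 <= sqd (vert s c d j) (vert s c' d' j')) /\
  (j <> j' -> 16/100 <= sqd (vert s c d j) (vert s c' d' j')).
Proof.
  intros Hs R R' Hj Hj'. pose proof (rotation_gap _ _ _ _ R R') as [HK HS].
  destruct R as [H _], R' as [H' _].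
  rewrite (vert_sqd _ _ _ _ _ _ _ H H').
  pose proof (hexagon_angles j j' Hj Hj') as Ht. cbv zeta in Ht.
  pose proof h3_bounds as Hb.
  assert (Hrad : forall i, 49/100 <= 1/2 + sgn i * s).
  { intros i. destruct (sgn_cases i) as [-> | ->]; lra. }
  assert (HKd : (d - d') ^ 2 <= 2 - 2 * (c * c' + d * d')).
  { pose proof (pow2_ge_0 (c - c')). nra. }
  set (K := c * c' + d * d') in *. set (S := d * c' - c * d') in *.
  set (D := cos60 j * cos60 j' + sin60 j * sin60 j') in *.
  set (C := cos60 j * sin60 j' - sin60 j * cos60 j') in *.
  clearbody K S D C. set (x := (d - d') ^ 2) in *.
  assert (Hx : 0 <= x) by apply pow2_ge_0. clearbody x.
  destruct Ht as [[<- [E1 E2]]|[[Hn [Es [E1 E2]]]|[Hn [Es [E1 E2]]]]];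
    (split; intros Hjj; [try contradiction|try (exfalso; tauto)]).
  - rewrite E1, E2. replace (1 * K + 0 * S) with K by ring.
    apply separation_small; [apply Hrad|lra].
  - apply separation_large; [apply Hrad..|]. rewrite E1. nra.
  - apply separation_large; [apply Hrad..|]. nra.
Qed.

(** Strictness comes from [s > 0]: for opposite parity the squared distance is at least [(1/2 + 2
    s^2) - (1/4 - s^2) = 1/4 + 3 s^2]. *)
Lemma vert_hexagon s c d j j' :
  0 < s <= 1/100 -> small_rotation c d ->
  (j < 6)%nat -> (j' < 6)%nat -> j <> j' ->
  1/4 < sqd (vert s c d j) (vert s c d j').
Proof.
  intros Hs [H _] Hj Hj' Hn.
  rewrite (vert_sqd _ _ _ _ _ _ _ H H).
  pose proof (hexagon_angles j j' Hj Hj') as Ht. cbv zeta in Ht.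
  set (D := cos60 j * cos60 j' + sin60 j * sin60 j') in *.
  rewrite H. replace (d * c - c * d) with 0 by ring.
  destruct Ht as [[E _]|[[_ [Es [E1 _]]]|[_ [Es [E1 _]]]]]; [contradiction| |];
    rewrite Es; clearbody D.
  - rewrite E1. destruct (sgn_cases j) as [-> | ->]; nra.
  - assert (HW : 0 <= 1/4 - s ^ 2) by nra.
    apply Rmult_le_compat_l with (1 := HW) in E1.
    assert (Hs2 : 0 < s ^ 2) by (apply pow_lt; lra).
    destruct (sgn_cases j) as [-> | ->]; lra.
Qed.

(** Both [y] and [y'] are almost 1/2 away from [p], so each is nearly antipodal to [p] in the disc:
    the parallelogram law puts it within [sqrt (s + e)] of [2c - p]. Hence they are close to each
    other. *)
Lemma disc_near_origin s e c p y y' :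
  0 <= s -> 0 < e -> s + e <= 1/2 ->
  fst p ^ 2 + snd p ^ 2 <= e ^ 2 ->
  (1/2 - s) ^ 2 <= fst y ^ 2 + snd y ^ 2 ->
  (1/2 - s) ^ 2 <= fst y' ^ 2 + snd y' ^ 2 ->
  sqd c p <= (1/4) ^ 2 -> sqd c y <= (1/4) ^ 2 -> sqd c y' <= (1/4) ^ 2 ->
  sqd y y' <= 4 * (s + e).
Proof.
  intros Hs He Hse Hp Hy Hy' Dp Dy Dy'.
  assert (Hfar : forall z, (1/2 - s) ^ 2 <= fst z ^ 2 + snd z ^ 2 ->
    1/4 - (s + e) <= sqd p z).
  { intros z Hz.
    set (rho := 1/2 - s) in *.
    (* Multiplied out, this square gives [|p - z| >= rho - e] without square roots. *)
    assert (Hw : 0 <= (e * fst z - rho * fst p) ^ 2 + (e * snd z - rho * snd p) ^ 2)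
      by (apply Rplus_le_le_0_compat; apply pow2_ge_0).
    assert (H1 : e * (rho - e) * rho ^ 2 <= e * (rho - e) * (fst z ^ 2 + snd z ^ 2)).
    { apply Rmult_le_compat_l; [|assumption]. unfold rho. nra. }
    assert (H2 : rho * (rho - e) * (fst p ^ 2 + snd p ^ 2) <= rho * (rho - e) * e ^ 2).
    { apply Rmult_le_compat_l; [|assumption]. unfold rho. nra. }
    assert (H3 : e * rho * (rho - e) ^ 2 <= e * rho * sqd p z) by (unfold sqd; lra).
    apply Rmult_le_reg_l in H3; [|unfold rho; nra].
    unfold rho in H3. pose proof (pow2_ge_0 (s + e)). lra. }
  apply Hfar in Hy, Hy'.
  assert (Hmid : forall z, sqd c z <= (1/4) ^ 2 -> 1/4 - (s + e) <= sqd p z ->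
    (2 * fst c - fst p - fst z) ^ 2 + (2 * snd c - snd p - snd z) ^ 2 <= s + e).
  { unfold sqd in *. intros z. intros. nra. }
  apply Hmid in Hy, Hy'; [|assumption..].
  unfold sqd.
  set (a := 2 * fst c - fst p - fst y) in *. set (a' := 2 * fst c - fst p - fst y') in *.
  set (b := 2 * snd c - snd p - snd y) in *. set (b' := 2 * snd c - snd p - snd y') in *.
  replace (fst y - fst y') with (a' - a) by (unfold a, a'; ring).
  replace (snd y - snd y') with (b' - b) by (unfold b, b'; ring).
  pose proof (pow2_ge_0 (a + a')). pose proof (pow2_ge_0 (b + b')). nra.
Qed.

(** * The configuration of rotated hexagons and a short segment *)

Definition eps (m : nat) : R := 1 / (8000 * INR m ^ 2).

Definition rot_sin (m k : nat) : R := INR k / (10 * INR m).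

Definition rot_cos (m k : nat) : R := sqrt (1 - rot_sin m k ^ 2).

(** An index [i < 6 * m] encodes the copy [i mod m] and the vertex [i / m]. *)
Definition hexpt (m i : nat) : R * R :=
  vert (eps m ^ 2) (rot_cos m (i mod m)) (rot_sin m (i mod m)) (i / m).

(** Indices 0 and 1 give the two endpoints, so both are present once [m >= 2]. *)
Definition segpt (m k : nat) : R * R :=
  (match k with O => eps m | S _ => - eps m / INR k end, 0).

Lemma INR_ge1 m : (0 < m)%nat -> 1 <= INR m.
Proof. intros H. apply (le_INR 1). lia. Qed.

Lemma eps_bounds m : (0 < m)%nat -> 0 < eps m <= 1/8000 /\ eps m ^ 2 <= eps m.
Proof.
  intros Hm. apply INR_ge1 in Hm. unfold eps.
  assert (H1 : 1 <= INR m ^ 2) by nra.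
  assert (H : 0 < 1 / (8000 * INR m ^ 2) <= 1/8000).
  { split; [apply Rdiv_lt_0_compat; lra|].
    apply Rmult_le_compat_l; [lra|]. apply Rinv_le_contravar; lra. }
  split; [exact H|nra].
Qed.

Lemma small_rotation_rot m k : (k < m)%nat -> small_rotation (rot_cos m k) (rot_sin m k).
Proof.
  intros Hk. pose proof (INR_ge1 m ltac:(lia)) as Hm.
  pose proof (pos_INR k) as H0. apply lt_INR in Hk.
  assert (Hd : 0 <= rot_sin m k <= 1/10).
  { unfold rot_sin. split.
    - apply Rmult_le_pos; [lra|]. left. apply Rinv_0_lt_compat. lra.
    - apply Rmult_le_reg_r with (10 * INR m); [lra|].
      unfold Rdiv. rewrite Rmult_assoc, Rinv_l by lra. lra. }
  unfold small_rotation, rot_cos. split; [|split; [|exact Hd]].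
  - rewrite sqrt_sqrt; nra.
  - rewrite <- (sqrt_pow2 (99/100)) by lra. apply sqrt_le_1_alt. nra.
Qed.

Section Hexagons.

Variable m : nat.
Hypothesis Hm : (0 < m)%nat.

Let div6 i : (i < 6 * m)%nat -> (i / m < 6)%nat.
Proof. intros Hi. apply Nat.Div0.div_lt_upper_bound; lia. Qed.

Let rot i : small_rotation (rot_cos m (i mod m)) (rot_sin m (i mod m)).
Proof. apply small_rotation_rot, Nat.mod_upper_bound. lia. Qed.

Lemma div_mod_inj i j : (i mod m = j mod m -> i / m = j / m -> i = j)%nat.
Proof.
  intros H1 H2. rewrite (Nat.div_mod_eq i m), (Nat.div_mod_eq j m), H1, H2. reflexivity.
Qed.

Lemma hexpt_diameter i j :
  (i < 6 * m)%nat -> (j < 6 * m)%nat -> sqd (hexpt m i) (hexpt m j) <= 1.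
Proof.
  intros Hi Hj. pose proof (eps_bounds m Hm). unfold hexpt.
  apply vert_diameter; auto. nra.
Qed.

Lemma hexpt_class i j :
  (i < 6 * m)%nat -> (j < 6 * m)%nat -> (i mod m = j mod m)%nat -> i <> j ->
  1/4 < sqd (hexpt m i) (hexpt m j).
Proof.
  intros Hi Hj E Hij. pose proof (eps_bounds m Hm). unfold hexpt. rewrite E.
  apply vert_hexagon; auto.
  - split; [apply pow_lt|]; lra.
  - intros E'. apply Hij. now apply div_mod_inj.
Qed.

(** The constant in [eps] is chosen for this bound: neighbouring copies have sines [1 / (10 m)]
    apart, giving squared distance at least [24 / (10000 m^2)], while
    [8 * eps m = 1 / (1000 m^2)]. *)
Lemma hexpt_separation i j :
  (i < 6 * m)%nat -> (j < 6 * m)%nat -> i <> j ->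
  8 * eps m < sqd (hexpt m i) (hexpt m j).
Proof.
  intros Hi Hj Hij. pose proof (eps_bounds m Hm) as He. unfold hexpt.
  destruct (vert_separation (eps m ^ 2) _ _ _ _ _ _ ltac:(nra) (rot i) (rot j)
    (div6 i Hi) (div6 j Hj)) as [H1 H2].
  destruct (Nat.eq_dec (i / m) (j / m)) as [E|E].
  - eapply Rlt_le_trans; [|exact (H1 E)].
    assert (Hk : (i mod m <> j mod m)%nat)
      by (intros E'; apply Hij; now apply div_mod_inj).
    pose proof (INR_ge1 m Hm) as Hm1.
    assert (Hsq : 1 <= (INR (i mod m) - INR (j mod m)) ^ 2).
    { destruct (Nat.lt_total (i mod m) (j mod m)) as [L|[L|L]]; [|contradiction|];
        apply le_INR in L; rewrite S_INR in L; nra. }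
    unfold rot_sin, eps.
    replace (24/100 * (INR (i mod m) / (10 * INR m) - INR (j mod m) / (10 * INR m)) ^ 2)
      with (24/10000 * (INR (i mod m) - INR (j mod m)) ^ 2 * / INR m ^ 2)
      by (field; lra).
    replace (8 * (1 / (8000 * INR m ^ 2))) with (1/1000 * / INR m ^ 2) by (field; lra).
    apply Rmult_lt_compat_r; [apply Rinv_0_lt_compat; nra|lra].
  - specialize (H2 E). lra.
Qed.

Lemma hexpt_norm i :
  (1/2 - eps m ^ 2) ^ 2 <= fst (hexpt m i) ^ 2 + snd (hexpt m i) ^ 2
  <= (1/2 + eps m ^ 2) ^ 2.
Proof.
  pose proof (eps_bounds m Hm). unfold hexpt.
  rewrite vert_norm by apply rot.
  assert (Hs : 0 <= eps m ^ 2) by apply pow2_ge_0.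
  destruct (sgn_cases (i / m)) as [-> | ->]; lra.
Qed.

Lemma segpt_abs k : - eps m <= fst (segpt m k) <= eps m.
Proof.
  pose proof (eps_bounds m Hm) as He. destruct k as [|k]; unfold segpt; cbn [fst]; [lra|].
  pose proof (INR_ge1 (S k) ltac:(lia)) as Hk.
  assert (Hinv : 0 < / INR (S k) <= 1).
  { split; [apply Rinv_0_lt_compat; lra|]. rewrite <- Rinv_1.
    apply Rinv_le_contravar; lra. }
  unfold Rdiv. nra.
Qed.

Lemma segpt_inj k l : segpt m k = segpt m l -> k = l.
Proof.
  pose proof (eps_bounds m Hm) as He.
  assert (Hneg : forall k, - eps m / INR (S k) < 0).
  { intros k'. pose proof (INR_ge1 (S k') ltac:(lia)).
    assert (0 < / INR (S k')) by (apply Rinv_0_lt_compat; lra). unfold Rdiv. nra. }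
  unfold segpt. intros E. injection E as E.
  destruct k as [|k], l as [|l].
  - reflexivity.
  - specialize (Hneg l). lra.
  - specialize (Hneg k). lra.
  - apply Rmult_eq_reg_l in E; [|lra]. apply Rinv_eq_reg in E. now apply INR_eq.
Qed.

Definition hexagons : list (R * R) := map (hexpt m) (seq 0 (6 * m)).

Definition segment : list (R * R) := map (segpt m) (seq 0 m).

Lemma in_hexagons y :
  In y hexagons -> exists i, (i < 6 * m)%nat /\ y = hexpt m i.
Proof.
  intros H. apply in_map_iff in H. destruct H as [i [<- Hi]].
  apply in_seq in Hi. exists i. split; [lia|reflexivity].
Qed.

Lemma in_segment x :
  In x segment -> snd x = 0 /\ - eps m <= fst x <= eps m.
Proof.
  intros H. apply in_map_iff in H. destruct H as [k [<- _]].
  split; [reflexivity|apply segpt_abs].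
Qed.

Lemma hexagons_NoDup : NoDup hexagons.
Proof.
  apply NoDup_map_NoDup_ForallPairs; [|apply seq_NoDup].
  intros i j Hi Hj E. apply in_seq in Hi, Hj.
  destruct (Nat.eq_dec i j) as [|Hij]; [assumption|exfalso].
  pose proof (hexpt_separation i j ltac:(lia) ltac:(lia) Hij) as H.
  rewrite E in H. pose proof (eps_bounds m Hm). unfold sqd in H.
  rewrite !Rminus_diag in H. lra.
Qed.

Lemma in_Pn_hexagons : in_Pn (6 * m) hexagons.
Proof.
  split; [apply hexagons_NoDup|split].
  - unfold hexagons. now rewrite length_map, length_seq.
  - intros p q Hp Hq. apply in_hexagons in Hp, Hq.
    destruct Hp as [i [Hi ->]], Hq as [j [Hj ->]].
    apply dist2_le; [lra|]. rewrite pow1. now apply hexpt_diameter.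
Qed.

Lemma covered_hexagons c : (covered c (1/4) hexagons <= m)%nat.
Proof.
  apply (covered_classes c (1/4) m (hexpt m) (fun i => i mod m)); [apply seq_NoDup| |].
  - intros i _. apply Nat.mod_upper_bound. lia.
  - intros i j Hi Hj Ci Cj E. apply in_seq in Hi, Hj.
    destruct (Nat.eq_dec i j) as [|Hij]; [assumption|exfalso].
    apply inb_quarter in Ci, Cj.
    pose proof (hexpt_class i j ltac:(lia) ltac:(lia) E Hij).
    pose proof (sqd_disc _ _ _ _ Ci Cj). lra.
Qed.

Lemma in_Pn_config : in_Pn (7 * m) (hexagons ++ segment).
Proof.
  pose proof (eps_bounds m Hm) as He.
  assert (Hs : 0 <= eps m ^ 2) by apply pow2_ge_0.
  (* Positivity gives disjointness of the two lists, the upper bound gives the diameter. *)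
  assert (Hcross : forall x y, In x segment -> In y hexagons -> 0 < sqd x y <= 1).
  { intros x y Hx Hy. apply in_segment in Hx. destruct Hx as [Hx0 Hx1].
    apply in_hexagons in Hy. destruct Hy as [i [Hi ->]].
    pose proof (hexpt_norm i) as Hn. set (y := hexpt m i) in *. clearbody y.
    assert (Hn' : 24/100 <= fst y ^ 2 + snd y ^ 2 <= 26/100) by nra.
    assert (Hy : -1 <= fst y <= 1) by nra.
    unfold sqd. rewrite Hx0. nra. }
  split; [|split].
  - apply NoDup_app.
    + apply hexagons_NoDup.
    + apply NoDup_map_NoDup_ForallPairs; [|apply seq_NoDup].
      intros k l _ _. apply segpt_inj.
    + intros p Hp Hp'. pose proof (Hcross p p Hp' Hp) as H.
      unfold sqd in H. rewrite !Rminus_diag in H. lra.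
  - unfold hexagons, segment. rewrite length_app, !length_map, !length_seq. lia.
  - intros p q Hp Hq. apply dist2_le; [lra|]. rewrite pow1.
    apply in_app_or in Hp, Hq. destruct Hp as [Hp|Hp], Hq as [Hq|Hq].
    + apply in_hexagons in Hp, Hq.
      destruct Hp as [i [Hi ->]], Hq as [j [Hj ->]]. now apply hexpt_diameter.
    + replace (sqd p q) with (sqd q p) by (unfold sqd; ring). now apply Hcross.
    + now apply Hcross.
    + apply in_segment in Hp, Hq. destruct Hp as [Ep Hp], Hq as [Eq Hq].
      unfold sqd. rewrite Ep, Eq. nra.
Qed.

(** Two vertices in such a disc would have squared distance at most [4 (eps^2 + eps) <= 8 eps],
    against [hexpt_separation]. *)
Lemma hexagons_one c x :
  In x segment -> inb c (1/4) x = true -> (covered c (1/4) hexagons <= 1)%nat.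
Proof.
  intros Hx Cx. pose proof (eps_bounds m Hm) as He.
  apply (covered_classes c (1/4) 1 (hexpt m) (fun _ => 0%nat));
    [apply seq_NoDup|lia|].
  intros i j Hi Hj Ci Cj _. apply in_seq in Hi, Hj.
  destruct (Nat.eq_dec i j) as [|Hij]; [assumption|exfalso].
  apply in_segment in Hx. destruct Hx as [Hx0 Hx1].
  apply inb_quarter in Cx, Ci, Cj.
  pose proof (hexpt_separation i j ltac:(lia) ltac:(lia) Hij).
  pose proof (pow2_ge_0 (eps m)).
  pose proof (disc_near_origin (eps m ^ 2) (eps m) c x (hexpt m i) (hexpt m j)
    ltac:(lra) ltac:(lra) ltac:(lra) ltac:(rewrite Hx0; nra)
    (proj1 (hexpt_norm i)) (proj1 (hexpt_norm j)) Cx Ci Cj). lra.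
Qed.

(* By the parallelogram law [|y - (e,0)|^2 + |y + (e,0)|^2 = 2 |y|^2 + 2 e^2 > 1/2]. *)
Lemma segment_missing c y :
  (2 <= m)%nat -> In y hexagons -> inb c (1/4) y = true ->
  (covered c (1/4) segment < m)%nat.
Proof.
  intros Hm2 Hy Cy. apply in_hexagons in Hy. destruct Hy as [i [Hi ->]].
  replace m with (length segment) at 1
    by (unfold segment; now rewrite length_map, length_seq).
  assert (Hin : forall k, (k < 2)%nat -> In (segpt m k) segment).
  { intros k Hk. apply in_map, in_seq. lia. }
  destruct (inb c (1/4) (segpt m 0)) eqn:C0;
    [destruct (inb c (1/4) (segpt m 1)) eqn:C1|].
  - exfalso. apply inb_quarter in Cy, C0, C1.
    pose proof (sqd_disc _ _ _ _ C0 Cy) as D0.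
    pose proof (sqd_disc _ _ _ _ C1 Cy) as D1.
    pose proof (hexpt_norm i) as Hn. pose proof (eps_bounds m Hm) as He.
    assert (Hs : 0 < eps m ^ 2) by (apply pow_lt; lra).
    set (y := hexpt m i) in *. clearbody y.
    unfold sqd, segpt in D0, D1. simpl fst in D0, D1. simpl snd in D0, D1.
    (* From [|y| >= 1/2 - eps^2] the two squared distances add up to at least [1/2 + 2 eps^4], since
       the [eps^2] terms cancel; the disc allows only [1/2]. *)
    simpl INR in D1. unfold Rdiv in D1 at 1. rewrite Rinv_1 in D1. nra.
  - apply (covered_missing c (1/4) segment (segpt m 1)); [apply Hin; lia|assumption].
  - apply (covered_missing c (1/4) segment (segpt m 0)); [apply Hin; lia|assumption].
Qed.

(** A disc meeting only one of the two families is bounded by that family alone; one meeting both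
    covers at most [1 + (m - 1)] points. *)
Lemma covered_config c :
  (2 <= m)%nat -> (covered c (1/4) (hexagons ++ segment) <= m)%nat.
Proof.
  intros Hm2. rewrite covered_app.
  destruct (Nat.eq_dec (covered c (1/4) segment) 0) as [->|H].
  - pose proof (covered_hexagons c). lia.
  - destruct (covered_pos c (1/4) segment ltac:(lia)) as [x [Hx Cx]].
    pose proof (hexagons_one c x Hx Cx) as H1.
    destruct (Nat.eq_dec (covered c (1/4) hexagons) 0) as [->|H'].
    + pose proof (covered_length c (1/4) segment) as HL.
      unfold segment in HL at 2. rewrite length_map, length_seq in HL. lia.
    + destruct (covered_pos c (1/4) hexagons ltac:(lia)) as [y [Hy Cy]].
      pose proof (segment_missing c y Hm2 Hy Cy). lia.
Qed.

End Hexagons.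

(** * Upper bounds and the exact values *)

Lemma good_upper n N m P k :
  in_Pn N P -> (n <= N)%nat -> (forall c, (covered c (1/4) P <= m)%nat) ->
  good n (1/4) k -> (k <= m)%nat.
Proof.
  (* Dropping points never increases coverage, so a prefix of a larger configuration serves for
     [n]. *)
  intros HP Hn Hc Hk. destruct (Hk (firstn n P)) as [c Hkc].
  - now apply (in_Pn_firstn n N).
  - pose proof (covered_firstn c (1/4) n P). specialize (Hc c). lia.
Qed.

Lemma good_upper_config n m k :
  (2 <= m)%nat -> (n <= 7 * m)%nat -> good n (1/4) k -> (k <= m)%nat.
Proof.
  intros Hm Hn. apply (good_upper n (7 * m) m (hexagons m ++ segment m)).
  - apply in_Pn_config. lia.
  - assumption.
  - intros c. now apply covered_config; [lia|].
Qed.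

(* ceil(n/7) for natural n is (n + 6) / 7 (natural division). *)
Theorem theorem5 :
  (forall n : nat, (0 < n)%nat -> n <> 7%nat -> is_N n (1/4) ((n + 6) / 7)%nat) /\
  (exists k : nat, is_N 7 (1/4) k /\ (1 <= k <= 2)%nat).
Proof.
  split.
  - intros n Hn Hn7. split; [apply good_ceil|]. intros k Hk.
    (* The full configuration requires [m >= 2], which holds for the ceiling once [n >= 8]; smaller
       [n] use one hexagon. *)
    destruct (le_lt_dec n 6) as [Hs|Hs].
    + replace ((n + 6) / 7)%nat with 1%nat.
      * apply (good_upper n (6 * 1) 1 (hexagons 1)); [|lia| |exact Hk].
        -- apply in_Pn_hexagons. lia.
        -- intros c. apply covered_hexagons. lia.
      * apply Nat.div_unique with (n - 1)%nat; lia.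
    + pose proof (Nat.div_mod_eq (n + 6) 7).
      pose proof (Nat.mod_upper_bound (n + 6) 7 ltac:(lia)).
      apply (good_upper_config n); [lia|lia|exact Hk].
  (* Whether 2 is attained for [n = 7] is left open by a classical case split; the configuration
     with [m = 2] rules out 3. *)
  - destruct (classic (good 7 (1/4) 2)) as [H2|H2].
    + exists 2%nat. split; [split|lia]; [exact H2|].
      intros k Hk. apply (good_upper_config 7 2); [lia|lia|exact Hk].
    + exists 1%nat. split; [split|lia]; [exact (good_ceil 7)|].
      intros k Hk. destruct (le_lt_dec k 1); [assumption|exfalso].
      apply H2. intros P HP. destruct (Hk P HP) as [c Hc]. exists c. lia.
Qed.
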